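(* Let $S$ be an intra-regular AG-groupoid with left identity and let $A=(\mu_A,\gamma_A)$ be an intuitionistic fuzzy set (IFS) of $S$. Then the following statements are equivalent. (i) $A$ is an intuitionistic fuzzy left ideal of $S$. (ii) $A$ is an intuitionistic fuzzy right ideal of $S$. (iii) $A$ is an intuitionistic fuzzy two-sided ideal of $S$. (iv) $A$ is an intuitionistic fuzzy bi-ideal of $S$. (v) $A$ is an intuitionistic fuzzy generalized bi-ideal of $S$. (vi) $A$ is an intuitionistic fuzzy interior ideal of $S$. (vii) $A$ is an intuitionistic fuzzy quasi ideal of $S$. (viii) $A\circ\delta=A$ and $\delta\circ A=A$.
   Context: An AG-groupoid is a non-empty set $S$ with a binary operation (written by juxtaposition) satisfying $(ab)c=(cb)a$ for all $a,b,c\in S$. A left identity is an element $e\in S$ with $ea=a$ for all $a\in S$. $S$ is intra-regular if for every $a\in S$ there exist $x,y\in S$ with $a=(xa^2)y$, where $a^2=aa$. An intuitionistic fuzzy set (IFS) $A=(\mu_A,\gamma_A)$ of $S$ is a pair of functions $\mu_A,\gamma_A:S\to[0,1]$ with $0\le\mu_A(x)+\gamma_A(x)\le1$ for all $x\in S$. Write $\wedge=\min$, $\vee=\max$. $A\subseteq B$ means $\mu_A(x)\le\mu_B(x)$ and $\gamma_A(x)\ge\gamma_B(x)$ for all $x\in S$. $A\cap B$ is the IFS $(\mu_A\wedge\mu_B,\ \gamma_A\vee\gamma_B)$ (pointwise). The product $A\circ B=(\mu_A\circ\mu_B,\gamma_A\circ\gamma_B)$ is given by $(\mu_A\circ\mu_B)(a)=\bigvee_{a=bc}\{\mu_A(b)\wedge\mu_B(c)\}$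 (supremum over all $b,c\in S$ with $a=bc$) if $a=bc$ for some $b,c\in S$, and $0$ otherwise; $(\gamma_A\circ\gamma_B)(a)=\bigwedge_{a=bc}\{\gamma_A(b)\vee\gamma_B(c)\}$ (infimum) if $a=bc$ for some $b,c\in S$, and $1$ otherwise. $\delta=(S_\delta,\Theta_\delta)$ is the IFS with $S_\delta(x)=1$ and $\Theta_\delta(x)=0$ for all $x\in S$. An IFS $A$ of $S$ is an intuitionistic fuzzy: - AG-subgroupoid if $\mu_A(xy)\ge\mu_A(x)\wedge\mu_A(y)$ and $\gamma_A(xy)\le\gamma_A(x)\vee\gamma_A(y)$ for all $x,y\in S$; - left ideal if $\mu_A(xy)\ge\mu_A(y)$ and $\gamma_A(xy)\le\gamma_A(y)$ for all $x,y\in S$; - right ideal if $\mu_A(xy)\ge\mu_A(x)$ and $\gamma_A(xy)\le\gamma_A(x)$ for all $x,y\in S$; - two-sided ideal if it is both an intuitionistic fuzzy left ideal and an intuitionistic fuzzy right ideal; - generalized bi-ideal if $\mu_A((xa)y)\ge\mu_A(x)\wedge\mu_A(y)$ and $\gamma_A((xa)y)\le\gamma_A(x)\vee\gamma_A(y)$ for all $x,a,y\in S$; - bi-ideal if it is both an intuitionistic fuzzy AG-subgroupoid and an intuitionistic fuzzy generalized bi-ideal; - interior ideal if $\mu_A((xa)y)\ge\mu_A(a)$ and $\gamma_A((xa)y)\le\gamma_A(a)$ for all $x,a,y\in S$; - quasi ideal if $(A\circ\delta)\cap(\delta\circ A)\subseteq A$. *)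

(* Defs.v *)
From mathcomp Require Import all_boot all_order all_algebra.
From mathcomp Require Import lra.
From mathcomp Require Import boolp classical_sets reals.

Set Implicit Arguments.
Unset Strict Implicit.
Unset Printing Implicit Defensive.
Import Order.TTheory GRing.Theory Num.Theory.
Local Open Scope classical_set_scope.
Local Open Scope ring_scope.

Record agGroupoid := AGGroupoid {
  ag_sort :> Type;
  ag_mul : ag_sort -> ag_sort -> ag_sort;
  ag_nonempty : inhabited ag_sort;
  ag_left_invertive : forall a b c,
    ag_mul (ag_mul a b) c = ag_mul (ag_mul c b) a }.

Declare Scope ag_scope.
Delimit Scope ag_scope with AG.
Notation "a * b" := (ag_mul a b) : ag_scope.

Definition has_left_identity (S : agGroupoid) : Prop :=
  exists e : S, left_id e (@ag_mul S).

Definition intra_regular (S : agGroupoid) : Prop :=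
  forall a : S, exists x y : S, a = ((x * (a * a)) * y)%AG.

Record ifs (R : realType) (S : Type) := IFS {
  ifs_mu : S -> R;
  ifs_gamma : S -> R;
  ifs_mu_itv : forall x, 0 <= ifs_mu x <= 1;
  ifs_gamma_itv : forall x, 0 <= ifs_gamma x <= 1;
  ifs_sum_itv : forall x, 0 <= ifs_mu x + ifs_gamma x <= 1 }.

(* The interval conditions are propositions, so Leibniz equality of [ifs]
   is pointwise equality of both components. *)
Lemma ifs_ext (R : realType) (S : Type) (A B : ifs R S) :
  ifs_mu A =1 ifs_mu B -> ifs_gamma A =1 ifs_gamma B -> A = B.
Proof.
case: A B => [m g p q r] [m' g' p' q' r'] /= /funext em /funext eg.
by subst m' g'; congr IFS; exact: Prop_irrelevance.
Qed.

Definition ifs_sub (R : realType) (S : Type) (A B : ifs R S) : Prop :=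
  forall x, ifs_mu A x <= ifs_mu B x /\ ifs_gamma B x <= ifs_gamma A x.

Section Inter.
Variables (R : realType) (S : Type) (A B : ifs R S).

Definition mu_inter x := Num.min (ifs_mu A x) (ifs_mu B x).
Definition gamma_inter x := Num.max (ifs_gamma A x) (ifs_gamma B x).

Fact inter_mu_itv x : 0 <= mu_inter x <= 1.
Proof.
rewrite /mu_inter; have := ifs_mu_itv A x; have := ifs_mu_itv B x.
by case: (leP (ifs_mu A x) (ifs_mu B x)) => _; lra.
Qed.

Fact inter_gamma_itv x : 0 <= gamma_inter x <= 1.
Proof.
rewrite /gamma_inter; have := ifs_gamma_itv A x; have := ifs_gamma_itv B x.
by case: (leP (ifs_gamma A x) (ifs_gamma B x)) => _; lra.
Qed.

Fact inter_sum_itv x : 0 <= mu_inter x + gamma_inter x <= 1.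
Proof.
have /andP[m0 _] := inter_mu_itv x; have /andP[g0 _] := inter_gamma_itv x.
rewrite addr_ge0 //= /mu_inter /gamma_inter.
have := ifs_sum_itv A x; have := ifs_sum_itv B x.
by case: (leP (ifs_mu A x) (ifs_mu B x)) => ?;
  case: (leP (ifs_gamma A x) (ifs_gamma B x)) => ?; lra.
Qed.

Definition ifs_inter : ifs R S :=
  @IFS R S mu_inter gamma_inter inter_mu_itv inter_gamma_itv inter_sum_itv.

End Inter.

Section Product.
Variables (R : realType) (S : agGroupoid).

Definition factorable (a : S) : Prop := exists b c : S, a = (b * c)%AG.

(* Once [a] is factorable, both value sets below are nonempty subsets of
   [0, 1], so [sup] and [inf] do not fall back to their junk value 0. *)
Definition mu_prod (f g : S -> R) (a : S) : R :=
  if `[< factorable a >] then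
    sup [set r | exists b c : S,
      a = (b * c)%AG /\ r = Num.min (f b) (g c)]
  else 0.

Definition gamma_prod (f g : S -> R) (a : S) : R :=
  if `[< factorable a >] then
    inf [set r | exists b c : S,
      a = (b * c)%AG /\ r = Num.max (f b) (g c)]
  else 1.

Variables A B : ifs R S.

Local Notation mu := (mu_prod (ifs_mu A) (ifs_mu B)).
Local Notation gamma := (gamma_prod (ifs_gamma A) (ifs_gamma B)).

Fact prod_min_itv b c : 0 <= Num.min (ifs_mu A b) (ifs_mu B c) <= 1.
Proof.
have := ifs_mu_itv A b; have := ifs_mu_itv B c.
by case: (leP (ifs_mu A b) (ifs_mu B c)) => _; lra.
Qed.

Fact prod_max_itv b c : 0 <= Num.max (ifs_gamma A b) (ifs_gamma B c) <= 1.
Proof.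
have := ifs_gamma_itv A b; have := ifs_gamma_itv B c.
by case: (leP (ifs_gamma A b) (ifs_gamma B c)) => _; lra.
Qed.

Fact prod_min_max b c :
  Num.min (ifs_mu A b) (ifs_mu B c)
    + Num.max (ifs_gamma A b) (ifs_gamma B c) <= 1.
Proof.
have := ifs_sum_itv A b; have := ifs_sum_itv B c.
by case: (leP (ifs_mu A b) (ifs_mu B c)) => ?;
  case: (leP (ifs_gamma A b) (ifs_gamma B c)) => ?; lra.
Qed.

Fact prod_mu_itv a : 0 <= mu a <= 1.
Proof.
rewrite /mu_prod; case: asboolP => [[b [c abc]]|_]; last by rewrite lexx ler01.
apply/andP; split.
- have /andP[h _] := prod_min_itv b c; apply: (le_trans h); apply: ub_le_sup.
  + by exists 1 => r [b' [c' [_ ->]]]; have /andP[] := prod_min_itv b' c'.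
  + by exists b, c.
- apply: ge_sup; first by exists (Num.min (ifs_mu A b) (ifs_mu B c)), b, c.
  by move=> r [b' [c' [_ ->]]]; have /andP[] := prod_min_itv b' c'.
Qed.

Fact prod_gamma_itv a : 0 <= gamma a <= 1.
Proof.
rewrite /gamma_prod; case: asboolP => [[b [c abc]]|_];
  last by rewrite lexx ler01.
apply/andP; split.
- apply: lb_le_inf; first by exists (Num.max (ifs_gamma A b) (ifs_gamma B c)), b, c.
  by move=> r [b' [c' [_ ->]]]; have /andP[] := prod_max_itv b' c'.
- have /andP[_ h] := prod_max_itv b c; apply: le_trans h; apply: ge_inf.
  + by exists 0 => r [b' [c' [_ ->]]]; have /andP[] := prod_max_itv b' c'.
  + by exists b, c.
Qed.

Fact prod_sum_itv a : 0 <= mu a + gamma a <= 1.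
Proof.
have /andP[m0 _] := prod_mu_itv a; have /andP[g0 _] := prod_gamma_itv a.
rewrite addr_ge0 //= /mu_prod /gamma_prod.
case: asboolP => [[b [c abc]]|_]; last by rewrite add0r.
rewrite -lerBrDr; apply: ge_sup.
  by exists (Num.min (ifs_mu A b) (ifs_mu B c)), b, c.
move=> r [b' [c' [abc' ->]]]; rewrite lerBrDr addrC -lerBrDr.
apply: (@le_trans _ _ (Num.max (ifs_gamma A b') (ifs_gamma B c'))).
  apply: ge_inf; last by exists b', c'.
  by exists 0 => s [b2 [c2 [_ ->]]]; have /andP[] := prod_max_itv b2 c2.
by rewrite lerBrDr addrC prod_min_max.
Qed.

Definition ifs_prod : ifs R S :=
  @IFS R S mu gamma prod_mu_itv prod_gamma_itv prod_sum_itv.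

End Product.

Section Delta.
Variables (R : realType) (S : Type).

Fact delta_mu_itv (x : S) : 0 <= (1 : R) <= 1.
Proof. by rewrite ler01 lexx. Qed.

Fact delta_gamma_itv (x : S) : 0 <= (0 : R) <= 1.
Proof. by rewrite ler01 lexx. Qed.

Fact delta_sum_itv (x : S) : 0 <= (1 : R) + 0 <= 1.
Proof. by rewrite addr0 ler01 lexx. Qed.

Definition ifs_delta : ifs R S :=
  @IFS R S (fun=> 1) (fun=> 0) delta_mu_itv delta_gamma_itv delta_sum_itv.

End Delta.
Arguments ifs_delta {R S}.

Section Ideals.
Variables (R : realType) (S : agGroupoid) (A : ifs R S).
Local Notation mu := (ifs_mu A).
Local Notation gamma := (ifs_gamma A).

Definition if_subgroupoid : Prop := forall x y : S,
  Num.min (mu x) (mu y) <= mu (x * y)%AG /\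
  gamma (x * y)%AG <= Num.max (gamma x) (gamma y).

Definition if_left_ideal : Prop := forall x y : S,
  mu y <= mu (x * y)%AG /\ gamma (x * y)%AG <= gamma y.

Definition if_right_ideal : Prop := forall x y : S,
  mu x <= mu (x * y)%AG /\ gamma (x * y)%AG <= gamma x.

Definition if_two_sided_ideal : Prop := if_left_ideal /\ if_right_ideal.

Definition if_generalized_bi_ideal : Prop := forall x a y : S,
  Num.min (mu x) (mu y) <= mu ((x * a) * y)%AG /\
  gamma ((x * a) * y)%AG <= Num.max (gamma x) (gamma y).

Definition if_bi_ideal : Prop := if_subgroupoid /\ if_generalized_bi_ideal.

Definition if_interior_ideal : Prop := forall x a y : S,
  mu a <= mu ((x * a) * y)%AG /\ gamma ((x * a) * y)%AG <= gamma a.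

Definition if_quasi_ideal : Prop :=
  ifs_sub (ifs_inter (ifs_prod A ifs_delta) (ifs_prod ifs_delta A)) A.

End Ideals.

(* Main.v *)
Require Import Defs.
From mathcomp Require Import all_boot all_order all_algebra.
From mathcomp Require Import boolp classical_sets reals.

(** Every one of the eight conditions amounts to this: the membership degree
    does not decrease, and the non-membership degree does not increase, when
    passing from an element [a] to certain multiples of [a].  The conditions
    differ in the shape of the multiples; for a bi-ideal the useful ones are
    [(a v) a], where both outer factors agree and the minimum and maximum
    collapse.  In an intra-regular AG-groupoid with left identity [e] these
    shapes all describe the same elements: writing [a = (p (a a)) q] and
    rearranging the factors with [ag_mulACA], [ag_mulCA] and [ag_mul_flip]
    gives [aS = Sa] and [Sa] contained in [(aS)a] ([right_multiple_left],
    [left_multiple_right], [left_multiple_bi]); moreover [(Sa)S] is contained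
    in [aS] ([interior_multiple_right]) and [a = e a] lies in [Sa], hence also
    in [aS].  So each implication is a rewriting of a product into the shape
    required by the hypothesis.

    The conditions stated through [ifs_prod] are of the same nature, because
    [ifs_prod A B] is the least intuitionistic fuzzy set whose membership at
    each product [b c] is at least the minimum of that of [A] at [b] and [B] at
    [c], and whose non-membership is at most the corresponding maximum
    ([ifs_prod_subP]).  Hence inclusion of [ifs_prod A ifs_delta] in [A] is the
    right ideal condition, and inclusion of [ifs_prod ifs_delta A] in [A] the
    left ideal condition; the reverse inclusions hold because every element is
    a left and a right multiple of itself. *)

Set Implicit Arguments.
Unset Strict Implicit.
Unset Printing Implicit Defensive.
Import Order.TTheory GRing.Theory Num.Theory.

(** * Multiples in an intra-regular AG-groupoid with left identity *)

Section AGGroupoid.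
Variable S : agGroupoid.
Implicit Types a b c d p q v x y z : S.
Local Open Scope ag_scope.

Lemma ag_mulACA a b c d : (a * b) * (c * d) = (a * c) * (b * d).
Proof.
by rewrite ag_left_invertive (ag_left_invertive c d) ag_left_invertive.
Qed.

Variable e : S.
Hypothesis mul1a : left_id e (@ag_mul S).

Lemma ag_mulCA a b c : a * (b * c) = b * (a * c).
Proof. by rewrite -{1}[a]mul1a ag_mulACA mul1a. Qed.

Lemma ag_mul_flip a b c d : (a * b) * (c * d) = (d * c) * (b * a).
Proof.
by rewrite ag_mulCA (ag_left_invertive a) ag_mulCA ag_mulACA.
Qed.

Lemma interior_multiple_right x a y : exists v, (x * a) * y = a * v.
Proof.
by exists ((y * e) * x); rewrite -{1}[y]mul1a ag_mul_flip ag_mulCA.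
Qed.

Hypothesis regS : intra_regular S.

(** This is where intra-regularity enters: replacing [a] by [(p (a a)) q]
    lets the outer factor [z] be absorbed on the far side of the square. *)
Lemma left_multiple_square z a : exists w, z * a = (a * a) * w.
Proof.
have [p [q def_a]] := regS a; exists ((q * z) * p).
by rewrite {1}def_a ag_mulCA ag_mul_flip ag_mulCA.
Qed.

Lemma left_multiple_right z a : exists v, z * a = a * v.
Proof.
have [w ->] := left_multiple_square z a; exists ((a * e) * w).
by rewrite -{1}[w]mul1a ag_mulACA ag_mulCA.
Qed.

Lemma left_multiple_bi z a : exists v, z * a = (a * v) * a.
Proof.
have [w ->] := left_multiple_square z a; have [v wa] := left_multiple_right w a.
by exists v; rewrite ag_left_invertive wa.
Qed.

Lemma right_multiple_left a v : exists z, a * v = z * a.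
Proof.
have [p [q def_a]] := regS a; pose z := (q * v) * p; exists ((z * e) * a).
rewrite {1}def_a ag_left_invertive ag_mul_flip ag_left_invertive -/z.
by rewrite -[z in LHS]mul1a ag_mul_flip ag_left_invertive.
Qed.

End AGGroupoid.

(** * Products of intuitionistic fuzzy sets as least upper bounds *)

Section IfsProduct.
Variables (R : realType) (S : agGroupoid).
Implicit Types A B C : ifs R S.
Local Open Scope ring_scope.

Lemma ifs_sub_anti A B : ifs_sub A B -> ifs_sub B A -> A = B.
Proof.
move=> sAB sBA.
by apply: ifs_ext => x; have [? ?] := sAB x; have [? ?] := sBA x;
  apply/le_anti/andP.
Qed.

(** The universal property of the product: it replaces the suprema and infima
    over all factorizations by a condition on each single product.  The values
    0 and 1 taken at elements with no factorization are the extreme degrees,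
    hence they constrain nothing. *)
Lemma ifs_prod_subP A B C :
  ifs_sub (ifs_prod A B) C <->
  forall b c : S,
    Num.min (ifs_mu A b) (ifs_mu B c) <= ifs_mu C (b * c)%AG /\
    ifs_gamma C (b * c)%AG <= Num.max (ifs_gamma A b) (ifs_gamma B c).
Proof.
split=> [sABC b c|leC a].
  have fact_bc : factorable (b * c)%AG by exists b, c.
  have [] := sABC (b * c)%AG; rewrite /= /mu_prod /gamma_prod asboolT //.
  move=> mu_le gamma_le; split.
    apply: le_trans mu_le; apply: ub_le_sup; last by exists b, c.
    by exists 1 => _ [b' [c' [_ ->]]]; have /andP[] := prod_min_itv A B b' c'.
  apply: le_trans gamma_le _; apply: ge_inf; last by exists b, c.
  by exists 0 => _ [b' [c' [_ ->]]]; have /andP[] := prod_max_itv A B b' c'.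
rewrite /= /mu_prod /gamma_prod; case: asboolP => [[b [c def_a]]|_].
  split.
    apply: ge_sup; first by exists (Num.min (ifs_mu A b) (ifs_mu B c)), b, c.
    by move=> _ [b' [c' [-> ->]]]; have [] := leC b' c'.
  apply: lb_le_inf; first by exists (Num.max (ifs_gamma A b) (ifs_gamma B c)), b, c.
  by move=> _ [b' [c' [-> ->]]]; have [] := leC b' c'.
by have /andP[-> _] := ifs_mu_itv C a; have /andP[_ ->] := ifs_gamma_itv C a.
Qed.

Lemma min_mu_delta A x : Num.min (ifs_mu A x) 1 = ifs_mu A x.
Proof. by apply: min_idPl; have /andP[] := ifs_mu_itv A x. Qed.

Lemma max_gamma_delta A x : Num.max (ifs_gamma A x) 0 = ifs_gamma A x.
Proof. by apply: max_idPl; have /andP[] := ifs_gamma_itv A x. Qed.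

Lemma ifs_prod_delta_subP A C :
  ifs_sub (ifs_prod A ifs_delta) C <->
  forall b c : S, ifs_mu A b <= ifs_mu C (b * c)%AG /\
    ifs_gamma C (b * c)%AG <= ifs_gamma A b.
Proof.
rewrite ifs_prod_subP.
by split=> leC b c; have := leC b c; rewrite /= min_mu_delta max_gamma_delta.
Qed.

Lemma ifs_delta_prod_subP A C :
  ifs_sub (ifs_prod ifs_delta A) C <->
  forall b c : S, ifs_mu A c <= ifs_mu C (b * c)%AG /\
    ifs_gamma C (b * c)%AG <= ifs_gamma A c.
Proof.
rewrite ifs_prod_subP; split=> leC b c; have := leC b c;
  by rewrite /= minC maxC min_mu_delta max_gamma_delta.
Qed.

Lemma ifs_prod_delta_ge A b c :
  ifs_mu A b <= ifs_mu (ifs_prod A ifs_delta) (b * c)%AG /\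
  ifs_gamma (ifs_prod A ifs_delta) (b * c)%AG <= ifs_gamma A b.
Proof. by apply: (ifs_prod_delta_subP A _).1. Qed.

Lemma ifs_delta_prod_ge A b c :
  ifs_mu A c <= ifs_mu (ifs_prod ifs_delta A) (b * c)%AG /\
  ifs_gamma (ifs_prod ifs_delta A) (b * c)%AG <= ifs_gamma A c.
Proof. by apply: (ifs_delta_prod_subP A _).1. Qed.

(** A product that is both a right and a left multiple of [a] gets at least
    the degrees of [a] in both products with [ifs_delta]. *)
Lemma quasi_ideal_multiple A a v z :
    if_quasi_ideal A -> (a * v)%AG = (z * a)%AG ->
  ifs_mu A a <= ifs_mu A (a * v)%AG /\ ifs_gamma A (a * v)%AG <= ifs_gamma A a.
Proof.
move=> quasiA av_za; have [mu_le gamma_le] := quasiA (a * v)%AG.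
have [mu_r gamma_r] := ifs_prod_delta_ge A a v.
have := ifs_delta_prod_ge A z a; rewrite -av_za => -[mu_l gamma_l].
split; first by apply: le_trans mu_le; rewrite le_min mu_r mu_l.
by apply: le_trans gamma_le _; rewrite ge_max gamma_r gamma_l.
Qed.

End IfsProduct.

(** * Equivalence of the ideal conditions *)

Theorem theorem8 (R : realType) (S : agGroupoid) (A : ifs R S) :
  intra_regular S -> has_left_identity S ->
  [<-> if_left_ideal A;
       if_right_ideal A;
       if_two_sided_ideal A;
       if_bi_ideal A;
       if_generalized_bi_ideal A;
       if_interior_ideal A;
       if_quasi_ideal A;
       ifs_prod A ifs_delta = A /\ ifs_prod ifs_delta A = A].
Proof.
move=> regS [e mul1a].
have rl := right_multiple_left mul1a regS.
have lr := left_multiple_right mul1a regS.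
tfae.
- by move=> leftA x y; have [z ->] := rl x y; apply: leftA.
- by move=> rightA; split=> // x y; have [v ->] := lr x y; apply: rightA.
- move=> [leftA rightA]; split=> [x y | x a y].
    by have [mu_x gamma_x] := rightA x y; rewrite ge_min le_max mu_x gamma_x.
  have [mu_y gamma_y] := leftA (x * a)%AG y.
  by rewrite ge_min le_max mu_y gamma_y !orbT.
- by case.
- move=> biA x a y; have [v ->] := interior_multiple_right mul1a x a y.
  have [z ->] := rl a v; have [w ->] := left_multiple_bi mul1a regS z a.
  by have := biA a w a; rewrite minxx maxxx.
- move=> intA; have rightA : if_right_ideal A.
    by move=> x y; rewrite -{2 3}[x]mul1a; apply: intA.
  move=> x; have [mu_le gamma_le] := (ifs_prod_delta_subP A A).2 rightA x.
  by rewrite ge_min le_max mu_le gamma_le.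
- move=> quasiA; split; apply: ifs_sub_anti.
  + apply/ifs_prod_delta_subP => a v; have [z av_za] := rl a v.
    exact: quasi_ideal_multiple av_za.
  + move=> a; have [v ea_av] := lr e a.
    by have := ifs_prod_delta_ge A a v; rewrite -ea_av mul1a.
  + apply/ifs_delta_prod_subP => z a; have [v za_av] := lr z a.
    by rewrite za_av; apply: quasi_ideal_multiple (esym za_av).
  + by move=> a; have := ifs_delta_prod_ge A e a; rewrite mul1a.
- by move=> [_ dA]; apply/ifs_delta_prod_subP; rewrite dA.
Qed.
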